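(* Work in the reduced axiomatic system (ZF-AC+DC), i.e. Zermelo-Fraenkel set theory without the Axiom of Choice, together with the Principle of Dependent Choices (DC). Let $X$ be a nonempty set, let $d:X\times X\to R_+$ be an ultrametric on $X$, and let $T:X\to X$ be a map. Suppose that $T$ is $d$-strictly-nonexpansive, that is, $d(Tx,Ty)<d(x,y)$ for all $x,y\in X$ with $x\neq y$. In addition, suppose that $(X,d)$ is Cantor complete. Then $T$ is fix-singleton, i.e. $\mathrm{Fix}(T)=\{x\in X: x=Tx\}$ consists of exactly one point; whence, $T$ has a unique fixed point in $X$.
   Context: $R_+=[0,\infty[$. An ultrametric on a nonempty set $X$ is a mapping $d:X\times X\to R_+$ such that for all $x,y,z\in X$: $x=y$ iff $d(x,y)=0$; $d(x,y)=d(y,x)$; and $d(x,z)\le\max\{d(x,y),d(y,z)\}$. For $a\in X$ and $r\in R_+$, the $d$-closed sphere with center $a$ and radius $r$ is $X[a,r]=\{x\in X: d(a,x)\le r\}$ (radius $r=0$ is allowed). The ultrametric space $(X,d)$ is called Cantor complete if every sequence $(M_n=X[a_n,r_n];\ n\ge 0)$ of $d$-closed spheres that is strictly decreasing for inclusion ($M_i\supsetneq M_j$ whenever $i<j$) has nonempty intersection $\bigcap_{n\ge 0}M_n$. Principle of Dependent Choices (DC): if $M$ is a nonempty set and $\mathcal R\subseteq M\times M$ is a relation such that for each $c\in M$ the section $\{y\in M: c\,\mathcal R\,y\}$ is nonempty, then for each $a\in M$ there exists a sequence $(x_n;\ n\ge 0)$ in $M$ with $x_0=a$ and $x_n\,\mathcal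 R\,x_{n+1}$ for all $n$. *)

(* Defs.v *)
(* Subsets are predicates ([Ensemble]) and the reals are those of Stdlib, whose
   axioms (functional extensionality and decidability of universally quantified
   decidable predicates on nat) are not choice principles; the only such
   principle in play is [dependent_choice]. *)
From Stdlib Require Import Reals Ensembles.
Open Scope R_scope.

(* The Principle of Dependent Choices is a proposition to be assumed
   explicitly, because it stands for the "+DC" of ZF-AC+DC. *)
Definition dependent_choice : Prop :=
  forall (M : Type) (rel : M -> M -> Prop),
    inhabited M ->
    (forall c : M, exists y : M, rel c y) ->
    forall a : M, exists x : nat -> M,
      x 0%nat = a /\ forall n : nat, rel (x n) (x (S n)).

Record is_ultrametric (X : Type) (d : X -> X -> R) : Prop := {
  um_nonneg : forall x y : X, 0 <= d x y;
  um_separated : forall x y : X, x = y <-> d x y = 0;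
  um_sym : forall x y : X, d x y = d y x;
  um_ultra : forall x y z : X, d x z <= Rmax (d x y) (d y z)
}.

Definition closed_sphere (X : Type) (d : X -> X -> R) (a : X) (r : R) :
  Ensemble X := fun x => d a x <= r.

(* Stdlib's [Strict_Included] uses Leibniz inequality of predicates, which is
   set-theoretic only up to extensionality; hence this version. *)
Definition strict_subset (X : Type) (A B : Ensemble X) : Prop :=
  Included X A B /\ ~ Included X B A.

Definition cantor_complete (X : Type) (d : X -> X -> R) : Prop :=
  forall (a : nat -> X) (r : nat -> R),
    (forall n : nat, 0 <= r n) ->
    (forall i j : nat, (i < j)%nat ->
      strict_subset X (closed_sphere X d (a j) (r j))
                      (closed_sphere X d (a i) (r i))) ->
    exists x : X, forall n : nat, In X (closed_sphere X d (a n) (r n)) x.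

Definition strictly_nonexpansive (X : Type) (d : X -> X -> R) (T : X -> X) :
  Prop := forall x y : X, x <> y -> d (T x) (T y) < d x y.

Definition Fix (X : Type) (T : X -> X) : Ensemble X := fun x => x = T x.

Definition fix_singleton (X : Type) (T : X -> X) : Prop :=
  exists z : X, Same_set X (Fix X T) (Singleton X z).

(* Main.v *)
Require Import Defs.
From Stdlib Require Import Reals Ensembles.
From Stdlib Require Import Lra Lia Classical.
Open Scope R_scope.

(** Uniqueness is immediate, since two distinct fixed points would be strictly
    closer to each other than they are.  For existence, attach to each point
    [x] the sphere [B x] centred at [x] with radius the displacement [d x (T x)].
    By the ultrametric inequality, moving to a point [y] of [B x] does not
    increase the displacement and gives [B y] inside [B x]; moreover [T x] lies
    in [B x], and its displacement is strictly smaller if [x] is not fixed.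

    Suppose that there is no fixed point.  A fixed point would be expected
    where the displacement is minimal, so dependent choice is used to pick
    [x (n+1)] in [B (x n)] greedily: its displacement is smaller than that of
    [x n], by at least half of what can be gained inside [B (x n)]
    ([near_minimal_point]).  The spheres [B (x n)] are strictly decreasing,
    hence have a common point [z] by Cantor completeness.  Now [T z] also lies in
    all these spheres, so that the greedy rule drives the displacements of the
    [x n] down to at most that of [T z] ([halving_limit]), whereas they all stay
    above the displacement of [z].  This contradicts the fact that [T] strictly
    lowers the displacement at [z].  No choice beyond that of the sequence is
    made. *)

(** The condition on [w] encodes an approximate infimum with only finite
    comparisons: [y] recovers at least half of the gap between [f x] and the
    infimum of [f] on [P].  This keeps the infimum itself out of the relation
    to which dependent choice is applied. *)
Lemma near_minimal_point (X : Type) (f : X -> R) (P : X -> Prop) (x w0 : X) :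
  (forall w, 0 <= f w) -> P w0 -> f w0 < f x ->
  exists y, P y /\ f y < f x /\ forall w, P w -> 2 * f y <= f x + f w.
Proof.
intros f_ge0 Pw0 lt_w0.
(* The infimum is obtained as the supremum of the opposite values. *)
set (E := fun t => exists w, P w /\ t = - f w).
destruct (completeness E) as [s [s_ub s_least]].
- exists 0; intros t [w [_ ->]]; specialize (f_ge0 w); lra.
- exists (- f w0), w0; auto.
- assert (s_le : forall w, P w -> - s <= f w).
  { intros w Pw; assert (- f w <= s) by (apply s_ub; exists w; auto); lra. }
  specialize (s_le w0 Pw0) as s_le_w0.
  destruct (classic (exists y, P y /\ 2 * f y < f x - s))
    as [[y [Py lt_y]] | no_y].
  + exists y; split; [exact Py | split; [lra |]].
    intros w Pw; specialize (s_le w Pw); lra.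
  + exfalso.
    (* Otherwise the midpoint of [- s] and [f x] would be a lower bound of [f]
       on [P] larger than [- s]. *)
    assert (s <= - ((f x - s) / 2)); [| lra].
    apply s_least; intros t [w [Pw ->]].
    destruct (Rlt_le_dec (2 * f w) (f x - s)); [| lra].
    exfalso; apply no_y; exists w; auto.
Qed.

(** As long as [u] stays above [b > a], each step lowers it by at least
    [b - a], which cannot go on forever. *)
Lemma halving_limit (u : nat -> R) (a b : R) :
  (forall n, 2 * u (S n) <= u n + a) -> (forall n, b <= u n) -> b <= a.
Proof.
intros halve lower.
destruct (Rle_lt_dec b a) as [| lt_ab]; [assumption | exfalso].
assert (descent : forall n, u n <= u 0%nat - INR n * (b - a)).
{ induction n as [| n IH]; [simpl; lra |].
  rewrite S_INR; specialize (halve n); specialize (lower (S n)); lra. }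
destruct (INR_unbounded ((u 0%nat - b) / (b - a))) as [n lt_n].
apply (Rmult_lt_compat_r (b - a)) in lt_n; [| lra].
unfold Rdiv in lt_n; rewrite Rmult_assoc, Rinv_l, Rmult_1_r in lt_n by lra.
specialize (descent n); specialize (lower n); lra.
Qed.

Lemma strictly_nonexpansive_le (X : Type) (d : X -> X -> R) (T : X -> X) :
  is_ultrametric X d -> strictly_nonexpansive X d T ->
  forall x y, d (T x) (T y) <= d x y.
Proof.
intros hd hT x y; destruct (classic (x = y)) as [<- | neq].
- rewrite (proj1 (um_separated X d hd (T x) (T x)) eq_refl).
  apply (um_nonneg X d hd).
- left; apply hT, neq.
Qed.

Lemma ultra_le (X : Type) (d : X -> X -> R) (hd : is_ultrametric X d)
  (r : R) (x y z : X) : d x y <= r -> d y z <= r -> d x z <= r.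
Proof.
intros; eapply Rle_trans; [apply (um_ultra X d hd x y z) |].
apply Rmax_lub; assumption.
Qed.

(** Each step of the path [y], [x], [T x], [T y] has length at most
    [d x (T x)]. *)
Lemma displacement_le_in_sphere (X : Type) (d : X -> X -> R) (T : X -> X) :
  is_ultrametric X d -> strictly_nonexpansive X d T ->
  forall x y, closed_sphere X d x (d x (T x)) y -> d y (T y) <= d x (T x).
Proof.
unfold closed_sphere; intros hd hT x y y_in.
apply ultra_le with x; [exact hd | rewrite (um_sym X d hd); exact y_in |].
apply ultra_le with (T x); [exact hd | lra |].
eapply Rle_trans; [apply strictly_nonexpansive_le; assumption | exact y_in].
Qed.

Lemma closed_sphere_incl (X : Type) (d : X -> X -> R) :
  is_ultrametric X d ->
  forall x y r s, closed_sphere X d x r y -> s <= r ->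
  Included X (closed_sphere X d y s) (closed_sphere X d x r).
Proof.
intros hd x y r s y_in le_sr z; unfold In, closed_sphere in *; intros z_in.
apply ultra_le with y; [exact hd | exact y_in | lra].
Qed.

(** A sphere of radius [s] has diameter at most [s], so that it cannot contain
    both [x] and [T x] once [s] is below their distance. *)
Lemma displacement_sphere_not_incl (X : Type) (d : X -> X -> R) (T : X -> X) :
  is_ultrametric X d ->
  forall x y s, s < d x (T x) ->
  ~ Included X (closed_sphere X d x (d x (T x))) (closed_sphere X d y s).
Proof.
intros hd x y s lt_s incl.
assert (x_in : d y x <= s).
{ apply incl; unfold In, closed_sphere.
  rewrite (proj1 (um_separated X d hd x x) eq_refl).
  apply (um_nonneg X d hd). }
assert (Tx_in : d y (T x) <= s) by (apply incl, Rle_refl).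
assert (d x (T x) <= s); [| lra].
apply ultra_le with y; [exact hd | rewrite (um_sym X d hd) |]; assumption.
Qed.

Lemma fixed_point_exists (DC : dependent_choice) (X : Type) (hX : inhabited X)
  (d : X -> X -> R) (hd : is_ultrametric X d) (T : X -> X)
  (hT : strictly_nonexpansive X d T) (hC : cantor_complete X d) :
  exists x, x = T x.
Proof.
apply NNPP; intros no_fix.
set (f := fun x => d x (T x)).
set (B := fun x => closed_sphere X d x (f x)).
assert (f_ge0 : forall x, 0 <= f x) by (intro; apply (um_nonneg X d hd)).
assert (f_lt : forall x, f (T x) < f x).
{ intro x; apply hT; intro eq; apply no_fix; exists x; exact eq. }
assert (T_in : forall x, B x (T x)) by (intro; apply Rle_refl).
assert (B_incl : forall x y, B x y -> Included X (B y) (B x)).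
{ intros x y y_in; apply closed_sphere_incl; auto.
  apply displacement_le_in_sphere; assumption. }
destruct hX as [x0].
destruct (DC X
  (fun x y => B x y /\ f y < f x /\ forall w, B x w -> 2 * f y <= f x + f w)
  (inhabits x0)) with (a := x0) as [x [_ step]].
{ intro c; apply near_minimal_point with (T c); auto. }
(* Strictness of the inclusion of spheres is not composed along the chain; it
   comes from comparing the radii of the two spheres. *)
assert (chain : forall i k, Included X (B (x (S k + i)%nat)) (B (x i)) /\
                            f (x (S k + i)%nat) < f (x i)).
{ intros i; induction k as [| k [incl lt_f]].
  - destruct (step i) as [y_in [lt_f _]]; split; [apply B_incl |]; assumption.
  - destruct (step (S k + i)%nat) as [y_in [lt_f' _]].
    change (S (S k) + i)%nat with (S (S k + i)).
    split; [| lra].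
    intros z z_in; apply incl, (B_incl _ _ y_in), z_in. }
destruct (hC x (fun n => f (x n))) as [z z_in].
{ intro; apply f_ge0. }
{ intros i j lt_ij.
  replace j with (S (j - S i) + i)%nat by lia.
  destruct (chain i (j - S i)%nat) as [incl lt_f].
  split; [exact incl | apply displacement_sphere_not_incl; assumption]. }
assert (f z <= f (T z)); [| specialize (f_lt z); lra].
apply (halving_limit (fun n => f (x n))).
- intro n; apply step, (B_incl _ _ (z_in n)), T_in.
- intro n; apply displacement_le_in_sphere; auto; apply z_in.
Qed.

Lemma fixed_point_unique (X : Type) (d : X -> X -> R) (T : X -> X) :
  strictly_nonexpansive X d T -> forall x y, x = T x -> y = T y -> x = y.
Proof.
intros hT x y eq_x eq_y; apply NNPP; intros neq.
specialize (hT x y neq); rewrite <- eq_x, <- eq_y in hT; lra.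
Qed.

Theorem theorem2 (DC : dependent_choice) (X : Type) (hX : inhabited X)
  (d : X -> X -> R) (hd : is_ultrametric X d) (T : X -> X)
  (hT : strictly_nonexpansive X d T) (hC : cantor_complete X d) :
  fix_singleton X T /\ exists! x : X, x = T x.
Proof.
destruct (fixed_point_exists DC X hX d hd T hT hC) as [z fix_z].
assert (uniq : forall y, y = T y -> z = y).
{ intros y fix_y; apply (fixed_point_unique X d T); assumption. }
split; exists z; split.
- intros y fix_y; rewrite <- (uniq y fix_y); apply In_singleton.
- intros y [ ]; exact fix_z.
- exact fix_z.
- exact uniq.
Qed.
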